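(* In the setting and under the regularity assumption of the context, fix $x\in\mathcal X$ (write $\ell_k(z)=\ell_k(x,z)$), $i\in[N]$, $1\le k_1<k_2\le K$ and $b\in\mathbb R_+$. For $\alpha\in A:=\{(\alpha_1,\alpha_2):\alpha_1+\alpha_2=1,\ \alpha_1,\alpha_2>0\}$ and $\beta\in B:=\{(\beta_1,\beta_2):\beta_1+\beta_2=b,\ \beta_1,\beta_2\ge0\}$ let $$\Psi_i^{(k_1,k_2)}(\alpha,\beta)=\max_{v_1,v_2}\Big\{\alpha_1\ell_{k_1}(\hat z_i+v_1)+\alpha_2\ell_{k_2}(\hat z_i+v_2): v_j\in\mathbb R^m,\ \hat z_i+v_j\in\mathcal Z,\ \alpha_jc(\hat z_i+v_j,\hat z_i)\le\beta_j,\ j\in\{1,2\}\Big\}.$$ Then: (i) for each fixed $\alpha\in A$, $\Psi_i^{(k_1,k_2)}(\alpha,\cdot)$ is concave in $\beta\in B$; (ii) the partial maximum $\Phi_i^{(k_1,k_2)}(\alpha):=\max_{\beta\in B}\Psi_i^{(k_1,k_2)}(\alpha,\beta)$ is concave in $\alpha\in A$.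
   Context: Notation: $[n]=\{1,\dots,n\}$; $\mathcal P(\mathcal Z)$ is the set of Borel probability measures on $\mathcal Z$. Setting. $\mathcal X\subseteq\mathbb R^n$, $\mathcal Z\subseteq\mathbb R^m$. A transportation cost $c:\mathcal Z\times\mathcal Z\to\mathbb R_+$ is lower semicontinuous, satisfies $c(z,z)=0$ for all $z$, and $c(\cdot,\hat z)$ is convex for every fixed $\hat z\in\mathcal Z$. The optimal transport discrepancy is $\mathrm{OT}_c(\mathbb P,\mathbb Q)=\min_{\gamma}\mathbb E_{(z,\hat z)\sim\gamma}[c(z,\hat z)]$ over couplings $\gamma$ of $\mathbb P$ and $\mathbb Q$. Given $\hat z_1,\dots,\hat z_N\in\mathcal Z$, let $\hat{\mathbb P}=\frac1N\sum_{i=1}^N\delta_{\hat z_i}$; given $\rho>0$, let $\mathcal P=\{\mathbb P\in\mathcal P(\mathcal Z):\mathrm{OT}_c(\mathbb P,\hat{\mathbb P})\le\rho\}$. Regularity assumption. (i) $\mathcal X$ is nonempty and convex; there exist $\mathbb Q_0\in\mathcal P$ and $x_0\in\mathcal X$ such that $x\mapsto\mathbb E_{z\sim\mathbb Q_0}[\ell(x,z)]$ is inf-compact on $\mathcal X$ (all sublevel sets are compact) and $\mathbb E_{z\sim\mathbb Q_0}[\ell(x_0,z)]>-\infty$; $\mathcal Z$ is nonempty, closed and convex. (ii) $\ell(x,z)=\max_{k\in[K]}\ell_k(x,z)$ with $K\ge2$, where each $\ell_k:\mathbb R^n\times\mathbb R^m\to\mathbb R$ is real-valued, convex in its first and concave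 in its second argument. (iii) There exist a norm $\|\cdot\|$ on $\mathbb R^m$ and $p\ge1$ with $c(z,\hat z)\ge\|z-\hat z\|^p$ for all $z,\hat z\in\mathcal Z$; moreover, if $p=1$, then for every $x\in\mathcal X$ there exist $g>0$, $\hat z_0\in\mathcal Z$ and $r\in[0,1)$ such that $\ell(x,z)\le g[1+\|z-\hat z_0\|^r]$ for all $z\in\mathcal Z$. *)

(* Defs.v *)
From HB Require Import structures.
From mathcomp Require Import all_boot all_order all_algebra.
From mathcomp Require Import all_classical all_reals all_analysis.

Set Implicit Arguments.
Unset Strict Implicit.
Unset Printing Implicit Defensive.

Import Order.TTheory GRing.Theory Num.Theory.
Import numFieldNormedType.Exports.

Local Open Scope classical_set_scope.
Local Open Scope ring_scope.

Definition concave_function (R : realType) (E : lmodType R) (D : set E)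
    (f : E -> R) : Prop :=
  @convex_function R E D (fun x => - f x).

Definition is_max (R : realType) (S : set R) (y : R) : Prop :=
  S y /\ ubound S y.

Definition is_norm (R : realType) (m : nat) (nu : 'rV[R]_m -> R) : Prop :=
  [/\ forall u v, nu (u + v) <= nu u + nu v,
      forall (a : R) u, nu (a *: u) = `|a| * nu u
    & forall u, nu u = 0 -> u = 0].

(* R^m with its Borel sigma-algebra; the product sigma-algebra on
   borel R m * borel R m is then the Borel one on R^m x R^m. *)
Definition borel (R : realType) (m : nat) :=
  g_sigma_algebraType (@open 'rV[R]_m).

(* Equality of marginals is required on Borel sets only, because the value of a
   library measure on a non-measurable set is arbitrary. *)
Definition coupling (R : realType) (m : nat)
    (P Q : set (borel R m) -> \bar R)
    (gamma : probability (borel R m * borel R m)%type R) : Prop :=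
  forall A : set (borel R m), measurable A ->
    pushforward gamma fst A = P A /\ pushforward gamma snd A = Q A.

(* The cost only matters on Z * Z, which has full gamma-measure whenever the
   marginals of gamma are concentrated on Z. *)
Definition OT (R : realType) (m : nat) (Z : set 'rV[R]_m)
    (c : 'rV[R]_m -> 'rV[R]_m -> R) (P Q : set (borel R m) -> \bar R) : \bar R :=
  ereal_inf [set (\int[gamma]_(u in Z `*` Z) (c u.1 u.2)%:E)%E |
              gamma in [set gamma : probability _ R | coupling P Q gamma]].

Definition empirical (R : realType) (m N : nat) (zhat : 'I_N -> 'rV[R]_m)
    (A : set (borel R m)) : \bar R :=
  ((N%:R^-1)%:E * \sum_(i < N) \d_(zhat i : borel R m) A)%E.

(* Borel probability measures on Z are those on R^m giving mass one to Z. *)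
Definition ambiguity_set (R : realType) (m N : nat) (Z : set 'rV[R]_m)
    (c : 'rV[R]_m -> 'rV[R]_m -> R) (zhat : 'I_N -> 'rV[R]_m) (rho : R) :
    set (probability (borel R m) R) :=
  [set P | P Z = 1%E /\ (OT Z c P (empirical zhat) <= rho%:E)%E].

Record transport_cost (R : realType) (m : nat) (Z : set 'rV[R]_m)
    (c : 'rV[R]_m -> 'rV[R]_m -> R) : Prop := {
  cost_ge0 : forall z zh, Z z -> Z zh -> 0 <= c z zh ;
  cost_lsc : lower_semicontinuous
    (fun u : subspace (Z `*` Z) => (c u.1 u.2)%:E) ;
  cost_refl : forall z, Z z -> c z z = 0 ;
  cost_convex : forall zh, Z zh -> @convex_function R 'rV[R]_m Z (c^~ zh)
}.

Definition expected_loss (R : realType) (n m : nat) (Z : set 'rV[R]_m)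
    (l : 'rV[R]_n -> 'rV[R]_m -> R) (Q : probability (borel R m) R)
    (x : 'rV[R]_n) : \bar R :=
  (\int[Q]_(z in Z) (l x z)%:E)%E.

Record regularity (R : realType) (n m N K : nat)
    (X : set 'rV[R]_n) (Z : set 'rV[R]_m)
    (c : 'rV[R]_m -> 'rV[R]_m -> R) (zhat : 'I_N -> 'rV[R]_m) (rho : R)
    (l : 'rV[R]_n -> 'rV[R]_m -> R)
    (lk : 'I_K -> 'rV[R]_n -> 'rV[R]_m -> R) : Prop := {
  reg_X_neq0 : X !=set0 ;
  reg_X_convex : @convex_set R 'rV[R]_n X ;
  reg_inf_compact : exists Q0 x0,
    [/\ ambiguity_set Z c zhat rho Q0, X x0,
        forall t : R,
          compact [set x | X x /\ (expected_loss Z l Q0 x <= t%:E)%E]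
      & (-oo < expected_loss Z l Q0 x0)%E] ;
  reg_Z_neq0 : Z !=set0 ;
  reg_Z_closed : closed Z ;
  reg_Z_convex : @convex_set R 'rV[R]_m Z ;
  reg_K : (2 <= K)%N ;
  reg_loss : forall x z, is_max (range (fun k => lk k x z)) (l x z) ;
  reg_loss_convex : forall k z,
    @convex_function R 'rV[R]_n setT (fun x => lk k x z) ;
  reg_loss_concave : forall k x,
    @concave_function R 'rV[R]_m setT (fun z => lk k x z) ;
  reg_growth : exists (nu : 'rV[R]_m -> R) (p : R),
    [/\ is_norm nu, 1 <= p,
        forall z zh, Z z -> Z zh -> nu (z - zh) `^ p <= c z zh
      & p = 1 -> forall x, X x -> exists (g : R) (z0 : 'rV[R]_m) (r : R),
          [/\ 0 < g, Z z0, 0 <= r, r < 1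
            & forall z, Z z -> l x z <= g * (1 + nu (z - z0) `^ r)]]
}.

Definition weights (R : realType) : set (R^o * R^o) :=
  [set a | [/\ a.1 + a.2 = 1, 0 < a.1 & 0 < a.2]].

Definition budgets (R : realType) (b : R) : set (R^o * R^o) :=
  [set be | [/\ be.1 + be.2 = b, 0 <= be.1 & 0 <= be.2]].

(* l1 and l2 stand for the pieces l_{k1}(x, .) and l_{k2}(x, .), and zh for the
   i-th sample. *)
Definition Psi_values (R : realType) (m : nat) (Z : set 'rV[R]_m)
    (c : 'rV[R]_m -> 'rV[R]_m -> R) (zh : 'rV[R]_m) (l1 l2 : 'rV[R]_m -> R)
    (a be : R^o * R^o) : set R :=
  [set a.1 * l1 (zh + v.1) + a.2 * l2 (zh + v.2) |
    v in [set v : 'rV[R]_m * 'rV[R]_m |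
      [/\ Z (zh + v.1), Z (zh + v.2),
          a.1 * c (zh + v.1) zh <= be.1 & a.2 * c (zh + v.2) zh <= be.2]]].

Definition Psi (R : realType) (m : nat) (Z : set 'rV[R]_m)
    (c : 'rV[R]_m -> 'rV[R]_m -> R) (zh : 'rV[R]_m) (l1 l2 : 'rV[R]_m -> R)
    (a be : R^o * R^o) : R :=
  sup (Psi_values Z c zh l1 l2 a be).

Definition Phi_values (R : realType) (m : nat) (Z : set 'rV[R]_m)
    (c : 'rV[R]_m -> 'rV[R]_m -> R) (zh : 'rV[R]_m) (l1 l2 : 'rV[R]_m -> R)
    (b : R) (a : R^o * R^o) : set R :=
  [set Psi Z c zh l1 l2 a be | be in budgets b].

Definition Phi (R : realType) (m : nat) (Z : set 'rV[R]_m)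
    (c : 'rV[R]_m -> 'rV[R]_m -> R) (zh : 'rV[R]_m) (l1 l2 : 'rV[R]_m -> R)
    (b : R) (a : R^o * R^o) : R :=
  sup (Phi_values Z c zh l1 l2 b a).

(* Main.v *)
(* A finite convex function on R^m is bounded above on a box around each point,
   hence locally Lipschitz at it.  Consequently the pieces of the loss are
   continuous, and every norm dominates a multiple of the sup norm; the growth
   condition and the lower semicontinuity of the cost then make its sublevel
   sets compact, so the maximum defining Psi exists.  Maximizing over the budget
   split as well amounts to maximizing over the compact set
   a1 c(z1, zh) + a2 c(z2, zh) <= b.  Both concavity claims follow from joint
   concavity of Psi in (alpha, beta): maximizers z_j, z'_j for (alpha, beta) and
   (alpha', beta') are combined into
   (t alpha_j z_j + (1 - t) alpha'_j z'_j) / (t alpha_j + (1 - t) alpha'_j). *)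
Require Import Defs.
From mathcomp Require Import all_boot all_order all_algebra.
From mathcomp Require Import all_classical all_reals all_analysis.
From mathcomp Require Import ring lra.

Set Implicit Arguments.
Unset Strict Implicit.
Unset Printing Implicit Defensive.

Import Order.TTheory GRing.Theory Num.Theory.
Import numFieldNormedType.Exports.

Local Open Scope classical_set_scope.
Local Open Scope ring_scope.

(** * Convexity and concavity with an explicit real weight *)

Lemma scaler_convmm (R : realType) (E : lmodType R) (t : R) (x : E) :
  t *: x + (1 - t) *: x = x.
Proof. by rewrite -scalerDl subrKC scale1r. Qed.

Lemma convex_function_le (R : realType) (E : lmodType R) (D : set E)
    (f : E -> R) (t : R) (x y : E) :
  @convex_function R E D f -> D x -> D y -> 0 <= t -> t <= 1 ->
  f (t *: x + (1 - t) *: y) <= t * f x + (1 - t) * f y.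
Proof.
by move=> cf Dx Dy t0 t1; apply: (cf (Itv01 t0 t1)); apply/mem_set.
Qed.

Lemma concave_function_ge (R : realType) (E : lmodType R) (D : set E)
    (f : E -> R) (t : R) (x y : E) :
  @concave_function R E D f -> D x -> D y -> 0 <= t -> t <= 1 ->
  t * f x + (1 - t) * f y <= f (t *: x + (1 - t) *: y).
Proof.
move=> cf Dx Dy t0 t1.
have := convex_function_le cf Dx Dy t0 t1; lra.
Qed.

Lemma convex_set_conv (R : realType) (E : lmodType R) (D : set E)
    (t : R) (x y : E) :
  @convex_set R E D -> D x -> D y -> 0 <= t -> t <= 1 ->
  D (t *: x + (1 - t) *: y).
Proof.
by move=> cD Dx Dy t0 t1; apply/set_mem/(cD x y (Itv01 t0 t1)); exact/mem_set.
Qed.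

Lemma concave_functionI (R : realType) (E : lmodType R) (D : set E)
    (f : E -> R) :
  (forall (t : R) (x y : E), 0 <= t -> t <= 1 -> D x -> D y ->
    t * f x + (1 - t) * f y <= f (t *: x + (1 - t) *: y)) ->
  @concave_function R E D f.
Proof.
move=> H t x y /set_mem Dx /set_mem Dy.
have oppr_conv (s u v w : R) :
  s * u + (1 - s) * v <= w -> - w <= s * - u + (1 - s) * - v by lra.
exact: oppr_conv (H t%:num x y (ge0 t) (le1 t) Dx Dy).
Qed.

(** * Continuity of finite convex functions and comparison of norms *)

(* The coordinate vectors are peeled off one at a time by taking midpoints,
   which doubles the radius of the box; hence [r] is generalized. *)
Lemma convex_bounded_span (R : realType) (m : nat) (f : 'rV[R]_m -> R)
    (s : seq 'I_m) (r : R) :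
  @convex_function R 'rV[R]_m setT f -> 0 < r ->
  exists M, forall a : 'I_m -> R, (forall i, `|a i| <= r) ->
    f (\sum_(i <- s) a i *: 'e_i) <= M.
Proof.
move=> cf; elim: s r => [|i s IH] r r0.
  by exists (f 0) => a _; rewrite big_nil.
have [M HM] := IH (2 * r) ltac:(lra).
pose e : 'rV[R]_m := (2 * r) *: 'e_i.
(* The sum is the midpoint of [(2 * a i) *: 'e_i], which lies on the segment from [- e] to [e], and
   of the tail with doubled coefficients, to which [M] applies. *)
exists (2^-1 * Num.max (f e) (f (- e)) + 2^-1 * M) => a ar.
have h01 : 0 <= 2^-1 :> R by lra.
have h11 : 2^-1 <= 1 :> R by lra.
have hE : 1 - 2^-1 = 2^-1 :> R by lra.
have -> : \sum_(j <- i :: s) a j *: 'e_j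
    = 2^-1 *: ((2 * a i) *: 'e_i)
      + (1 - 2^-1) *: (\sum_(j <- s) (2 * a j) *: 'e_j) :> 'rV[R]_m.
  rewrite big_cons hE scaler_sumr scalerA mulrA mulVf // mul1r; congr (_ + _).
  by apply: eq_bigr => j _; rewrite scalerA mulrA mulVf // mul1r.
apply: (le_trans (convex_function_le cf _ _ h01 h11)) => //.
rewrite hE; apply: lerD; apply: ler_wpM2l => //; last first.
  by apply: HM => j; rewrite normrM ger0_norm // ler_pM2l // ar.
have := ar i; rewrite ler_norml => /andP[ail air].
pose t := (a i + r) / (2 * r).
have r20 : 0 < 2 * r by lra.
have t0 : 0 <= t by apply: divr_ge0; lra.
have t1 : t <= 1 by rewrite ler_pdivrMr // mul1r; lra.
have -> : (2 * a i) *: 'e_i = t *: e + (1 - t) *: - e :> 'rV[R]_m.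
  rewrite scalerN -scaleNr -scalerDl /e scalerA; congr (_ *: _).
  by rewrite /t; field; lra.
apply: (le_trans (convex_function_le cf _ _ t0 t1)) => //.
have m1 : f e <= Num.max (f e) (f (- e)) by rewrite le_max lexx.
have m2 : f (- e) <= Num.max (f e) (f (- e)) by rewrite le_max lexx orbT.
nra.
Qed.

Lemma coord_le_norm (R : realType) (m : nat) (u : 'rV[R]_m) (i : 'I_m) :
  `|u 0 i| <= `|u|.
Proof.
rewrite [leRHS](mx_normrE u).
by apply/bigmax_geP; right => /=; exists (0, i).
Qed.

(** With [M] bounding [f] on the unit ball around [x], convexity on the line through [x] and [x + u]
    bounds the increment on both sides by [|u| * (M - f x)]. *)
Lemma convex_continuous (R : realType) (m : nat) (f : 'rV[R]_m -> R) :
  @convex_function R 'rV[R]_m setT f -> continuous f.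
Proof.
move=> cf x.
have cg : @convex_function R 'rV[R]_m setT (fun u => f (x + u)).
  move=> t u v _ _.
  have := cf t (x + u) (x + v) (mem_set I) (mem_set I).
  congr (f _ <= _).
  change (t%:num *: (x + u) + (1 - t%:num) *: (x + v)
    = x + (t%:num *: u + (1 - t%:num) *: v)).
  by rewrite !scalerDr addrACA scaler_convmm.
have [M HM] := convex_bounded_span (index_enum _) cg ltr01.
have {}HM u : `|u| <= 1 -> f (x + u) <= M.
  move=> u1; rewrite [u]row_sum_delta; apply: HM => i.
  exact: le_trans (coord_le_norm _ _) u1.
have Mx : f x <= M by rewrite -[x]addr0; apply: HM; rewrite normr0.
have lip u : `|u| <= 1 -> `|f x - f (x + u)| <= `|u| * (M - f x).
  have [->|u0] := eqVneq u 0; first by rewrite addr0 subrr !normr0 mul0r.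
  set t := `|u| => t1.
  have t0 : 0 < t by rewrite normr_gt0.
  pose w := t^-1 *: u.
  have w1 : `|w| = 1.
    by rewrite normrZ ger0_norm ?invr_ge0 ?ltW // mulVf // gt_eqF.
  have uE : u = t *: w by rewrite scalerA mulfV ?gt_eqF // scale1r.
  (* Upper bound: [x + u] lies between [x] and the point [x + w] of the unit sphere around [x]. *)
  have A : f (x + u) <= t * f (x + w) + (1 - t) * f x.
    have := @convex_function_le _ _ _ _ t (x + w) x cf I I (ltW t0) t1.
    congr (f _ <= _).
    by rewrite scalerDr -uE addrAC scaler_convmm.
  (* Lower bound: [x] lies between [x + u] and the opposite point [x - w]; these are at distances
     [t] and [1] from [x], whence the weight [1 / (1 + t)]. *)
  have B : f x <= (1 + t)^-1 * f (x + u) + (1 - (1 + t)^-1) * f (x - w).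
    have i0 : 0 <= (1 + t)^-1 by rewrite invr_ge0; lra.
    have i1 : (1 + t)^-1 <= 1 by rewrite invf_le1; lra.
    have := @convex_function_le _ _ _ _ _ (x + u) (x - w) cf I I i0 i1.
    congr (f _ <= _).
    rewrite !scalerDr addrACA scaler_convmm.
    rewrite uE scalerN scalerA -scalerBl.
    rewrite [X in X *: w](_ : _ = 0) ?scale0r ?addr0 //.
    by field; lra.
  have wM : f (x + w) <= M by apply: HM; rewrite w1.
  have wNM : f (x - w) <= M by apply: HM; rewrite normrN w1.
  have {}B : (1 + t) * f x <= f (x + u) + t * f (x - w).
    have t2 : 0 < 1 + t by lra.
    rewrite -(ler_pM2l t2) in B; apply: (le_trans B).
    by rewrite le_eqVlt; apply/orP; left; apply/eqP; field; lra.
  rewrite ler_norml; apply/andP; split; nra.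
apply/(@cvgrPdist_le _ _ _ (nbhs x)) => e e0.
(* The added 1 keeps the divisor positive when [M = f x]. *)
have q0 : 0 < M - f x + 1 by lra.
near=> y.
have yd : `|x - y| <= Num.min 1 (e / (M - f x + 1)).
  near: y; apply: cvgr_dist_le; first exact: cvg_id.
  by rewrite lt_min ltr01 divr_gt0.
move: yd; rewrite le_min distrC => /andP[y1 ye].
have := lip (y - x) y1; rewrite subrKC => /le_trans; apply.
rewrite ler_pdivlMr // in ye; apply: le_trans ye.
by apply: ler_wpM2l => //; lra.
Unshelve. all: by end_near. Qed.

Lemma concave_continuous (R : realType) (m : nat) (f : 'rV[R]_m -> R) :
  @concave_function R 'rV[R]_m setT f -> continuous f.
Proof.
move=> /convex_continuous cf x; rewrite -[f]opprK; exact/continuousN/cf.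
Qed.

(** A norm is convex, hence continuous, so it attains a positive minimum on the compact unit sphere
    of the sup norm; homogeneity extends the bound to all vectors. *)
Lemma is_norm_ge_norm (R : realType) (m : nat) (nu : 'rV[R]_m -> R) :
  is_norm nu -> exists2 C, 0 < C & forall u, `|u| <= C * nu u.
Proof.
move=> [nuD nuZ nu0].
have nu00 : nu 0 = 0 by rewrite -(scale0r 0) nuZ normr0 mul0r.
have nu_ge0 u : 0 <= nu u.
  have := nuD u (- u); rewrite subrr nu00 -scaleN1r nuZ normrN normr1; lra.
have cnu : continuous nu.
  apply: convex_continuous => t u v _ _.
  apply: (le_trans (nuD _ _)); rewrite !nuZ convRE.
  by rewrite !ger0_norm // subr_ge0.
pose S := [set u : 'rV[R]_m | `|u| = 1].
(* The sphere is empty only in dimension 0, where every vector is zero. *)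
have [S0|/set0P S0] := eqVneq S set0.
  exists 1 => // u; have [->|u0] := eqVneq u 0; first by rewrite normr0 nu00 mulr0.
  suff : S (`|u|^-1 *: u) by rewrite S0.
  by rewrite /S /= normrZ normfV normr_id mulVf // normr_eq0.
have cS : compact S.
  apply: bounded_closed_compact.
    exists 1; split => // M M1 u /= ->; exact: ltW.
  have -> : S = Num.norm @^-1` [set 1 : R] by [].
  apply: closed_comp => [u _|]; first exact: norm_continuous.
  exact: closed_eq.
have [w /set_mem wS wmin] := compact_EVT_min S0 cS (continuous_subspaceT cnu).
have nuw : 0 < nu w.
  rewrite lt_def nu_ge0 andbT; apply/eqP => /nu0 w0.
  by move: wS; rewrite /S /= w0 normr0 => /eqP; rewrite eq_sym oner_eq0.
exists (nu w)^-1; first by rewrite invr_gt0.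
move=> u; have [->|u0] := eqVneq u 0; first by rewrite normr0 nu00 mulr0.
have nu1 : 0 < `|u| by rewrite normr_gt0.
have := wmin (`|u|^-1 *: u); rewrite nuZ ger0_norm ?invr_ge0 // => H.
rewrite ler_pdivlMl // mulrC -ler_pdivlMl //; apply: H; apply/mem_set.
by rewrite /S /= normrZ ger0_norm ?invr_ge0 // mulVf // gt_eqF.
Qed.

(** * Attained maxima, and convexity of the weight and budget sets *)

Lemma is_max_sup (R : realType) (S : set R) (y : R) : is_max S y -> sup S = y.
Proof.
move=> [Sy ubS]; apply/eqP; rewrite eq_le ge_sup //=; last by exists y.
by apply: ub_le_sup => //; exists y.
Qed.

Lemma compact_image_max (R : realType) (T : topologicalType) (A : set T)
    (f : T -> R) :
  A !=set0 -> compact A -> continuous f ->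
  exists2 u, A u & is_max (f @` A) (f u).
Proof.
move=> A0 cA cf.
have [u /set_mem Au umax] := compact_EVT_max A0 cA (continuous_subspaceT cf).
exists u => //; split; first by exists u.
by move=> _ [v Av <-]; apply/umax/mem_set.
Qed.

Lemma weights_conv (R : realType) (t : R) (a a' : R^o * R^o) :
  0 <= t -> t <= 1 -> @weights R a -> @weights R a' ->
  @weights R (t *: a + (1 - t) *: a').
Proof.
move=> t0 t1; case: a a' => [a1 a2] [a1' a2'] [/= e p1 p2] [/= e' p1' p2'].
have cv (u v : R) : 0 < u -> 0 < v -> 0 < t * u + (1 - t) * v by nra.
split; [|exact: cv|exact: cv].
change ((t * a1 + (1 - t) * a1') + (t * a2 + (1 - t) * a2') = 1).
by rewrite addrACA -!mulrDr e e'; ring.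
Qed.

Lemma budgets_conv (R : realType) (b t : R) (be be' : R^o * R^o) :
  0 <= t -> t <= 1 -> budgets b be -> budgets b be' ->
  budgets b (t *: be + (1 - t) *: be').
Proof.
move=> t0 t1; case: be be' => [b1 b2] [b1' b2'] [/= e p1 p2] [/= e' p1' p2'].
have cv (u v : R) : 0 <= u -> 0 <= v -> 0 <= t * u + (1 - t) * v.
  by move=> u0 v0; rewrite addr_ge0 // mulr_ge0 // subr_ge0.
split; [|exact: cv|exact: cv].
change ((t * b1 + (1 - t) * b1') + (t * b2 + (1 - t) * b2') = b).
by rewrite addrACA -!mulrDr e e'; ring.
Qed.

(** * Compactness of the cost sublevel sets *)

Definition cost_sublevel (R : realType) (m : nat) (Z : set 'rV[R]_m)
    (c : 'rV[R]_m -> 'rV[R]_m -> R) (zh : 'rV[R]_m) (s : R) : set 'rV[R]_m :=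
  [set z | Z z /\ c z zh <= s].

(** For nonnegative costs and weights, this is the union over all budget splits of the feasible sets
    of [Psi], written in the points [zh + v] instead of the displacements. *)
Definition joint_sublevel (R : realType) (m : nat) (Z : set 'rV[R]_m)
    (c : 'rV[R]_m -> 'rV[R]_m -> R) (zh : 'rV[R]_m) (b : R) (a : R^o * R^o) :
    set ('rV[R]_m * 'rV[R]_m) :=
  [set z | [/\ Z z.1, Z z.2 & a.1 * c z.1 zh + a.2 * c z.2 zh <= b]].

(** Lower semicontinuity is given relative to [Z * Z]; slicing a product neighbourhood at [zh]
    yields a condition on the first argument alone. *)
Lemma cost_gt_near (R : realType) (m : nat) (Z : set 'rV[R]_m)
    (c : 'rV[R]_m -> 'rV[R]_m -> R) (zh z : 'rV[R]_m) (s : R) :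
  transport_cost Z c -> Z zh -> Z z -> s < c z zh ->
  \forall y \near z, Z y -> s < c y zh.
Proof.
move=> hc Zzh Zz sc.
have [] := @cost_lsc _ _ _ _ hc (z, zh) s; first by rewrite lte_fin.
move=> V /nbhs_subspace_ex[//|W [[P Q] /= [nP nQ] PQW]] VW Vs.
apply: filterS nP => y Py Zy; rewrite -lte_fin.
apply: (Vs (y, zh)).
have : (W `&` (Z `*` Z)) (y, zh).
  by split => //; apply: PQW; split => //=; exact: nbhs_singleton nQ.
by rewrite -VW => -[].
Qed.

Lemma cost_sublevel_closed (R : realType) (m : nat) (Z : set 'rV[R]_m)
    (c : 'rV[R]_m -> 'rV[R]_m -> R) (zh : 'rV[R]_m) (s : R) :
  transport_cost Z c -> closed Z -> Z zh -> closed (cost_sublevel Z c zh s).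
Proof.
move=> hc clZ Zzh z clz.
have Zz : Z z by apply: clZ => U /clz[y [[Zy _] Uy]]; exists y.
split => //; rewrite leNgt; apply/negP => sc.
have [y [[Zy ys] /(_ Zy)]] := clz _ (cost_gt_near hc Zzh Zz sc).
by rewrite ltNge ys.
Qed.

Lemma joint_sublevel_closed (R : realType) (m : nat) (Z : set 'rV[R]_m)
    (c : 'rV[R]_m -> 'rV[R]_m -> R) (zh : 'rV[R]_m) (b : R) (a : R^o * R^o) :
  transport_cost Z c -> closed Z -> Z zh -> @weights R a ->
  closed (joint_sublevel Z c zh b a).
Proof.
move=> hc clZ Zzh [a12 a1 a2] [z1 z2] clz.
have Zz1 : Z z1.
  apply: clZ => U nU.
  have [|y [[Zy _ _] [Uy _]]] := clz (U `*` setT); last by exists y.1.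
  by exists (U, setT) => //; split => //; exact: filterT.
have Zz2 : Z z2.
  apply: clZ => U nU.
  have [|y [[_ Zy _] [_ Uy]]] := clz (setT `*` U); last by exists y.2.
  by exists (setT, U) => //; split => //; exact: filterT.
split => //=; rewrite leNgt; apply/negP => bc.
(* Half of the excess over [b]. As the weights sum to 1, lowering both costs by [d] lowers the
   weighted sum by [d], which leaves it above [b]. *)
pose d := (a.1 * c z1 zh + a.2 * c z2 zh - b) / 2.
have d0 : 0 < d by rewrite divr_gt0 // subr_gt0.
have n1 : \forall y \near z1, Z y -> c z1 zh - d < c y zh.
  by apply: cost_gt_near => //; rewrite ltrBlDr ltrDl.
have n2 : \forall y \near z2, Z y -> c z2 zh - d < c y zh.
  by apply: cost_gt_near => //; rewrite ltrBlDr ltrDl.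
have [|y [[Zy1 Zy2 yb] [/(_ Zy1) /= y1 /(_ Zy2) /= y2]]] := clz
  ([set y | Z y -> c z1 zh - d < c y zh] `*`
   [set y | Z y -> c z2 zh - d < c y zh]).
  by exists ([set y | Z y -> c z1 zh - d < c y zh],
             [set y | Z y -> c z2 zh - d < c y zh]).
have e1 : a.1 * (c z1 zh - d) < a.1 * c y.1 zh by rewrite ltr_pM2l.
have e2 : a.2 * (c z2 zh - d) < a.2 * c y.2 zh by rewrite ltr_pM2l.
have : a.1 * (c z1 zh - d) + a.2 * (c z2 zh - d) = b + d.
  transitivity (a.1 * c z1 zh + a.2 * c z2 zh - (a.1 + a.2) * d); first ring.
  by rewrite a12 /d; field.
move: yb d0 e1 e2.
move: (a.1 * c y.1 zh) (a.2 * c y.2 zh) (a.1 * (c z1 zh - d))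
  (a.2 * (c z2 zh - d)) => u1 u2 u3 u4; lra.
Qed.

(** Growth gives boundedness: where [nu (z - zh) > 1], the exponent [p >= 1] yields [nu (z - zh) <=
    nu (z - zh) ^ p <= c z zh <= s]. Hence the radius [max 1 s], up to the norm comparison
    constant. *)
Lemma cost_sublevel_compact (R : realType) (m : nat) (Z : set 'rV[R]_m)
    (c : 'rV[R]_m -> 'rV[R]_m -> R) (zh : 'rV[R]_m) (nu : 'rV[R]_m -> R)
    (p s : R) :
  transport_cost Z c -> closed Z -> Z zh -> is_norm nu -> 1 <= p ->
  (forall z, Z z -> nu (z - zh) `^ p <= c z zh) ->
  compact (cost_sublevel Z c zh s).
Proof.
move=> hc clZ Zzh hnu p1 hgrow.
have [C C0 HC] := is_norm_ge_norm hnu.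
apply: bounded_closed_compact; last exact: cost_sublevel_closed.
exists (C * Num.max 1 s + `|zh|); split; first exact: num_real.
move=> M HM z [Zz cs]; apply/ltW/(le_lt_trans _ HM).
rewrite -[z](subrK zh); apply: (le_trans (ler_normD _ _)); rewrite lerD2r.
apply: (le_trans (HC _)); rewrite ler_pM2l // le_max.
have [//|nu1 /=] := leP (nu (z - zh)) 1.
have nu0 : 0 <= nu (z - zh) by lra.
apply: le_trans cs; apply: le_trans (hgrow _ Zz).
by rewrite -[leLHS]powRr1 // ler_powR // ltW.
Qed.

(** Both cost terms are nonnegative, so each is at most [b]; the set is closed inside a product of
    two compact sublevel sets. *)
Lemma joint_sublevel_compact (R : realType) (m : nat) (Z : set 'rV[R]_m)
    (c : 'rV[R]_m -> 'rV[R]_m -> R) (zh : 'rV[R]_m) (b : R) (a : R^o * R^o) :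
  transport_cost Z c -> closed Z -> Z zh -> @weights R a ->
  (forall s, compact (cost_sublevel Z c zh s)) ->
  compact (joint_sublevel Z c zh b a).
Proof.
move=> hc clZ Zzh wa cpt.
have clJ : closed (joint_sublevel Z c zh b a) by exact: joint_sublevel_closed.
apply: (subclosed_compact clJ (compact_setX (cpt (b / a.1)) (cpt (b / a.2)))).
case: wa => _ a1 a2 z [Zz1 Zz2 zb].
have c1 := cost_ge0 hc Zz1 Zzh; have c2 := cost_ge0 hc Zz2 Zzh.
split; split => //; rewrite ler_pdivlMr // mulrC; apply: le_trans zb.
  by rewrite lerDl mulr_ge0 // ltW.
by rewrite lerDr mulr_ge0 // ltW.
Qed.

(** * Existence of the maxima *)

Definition pair_loss (R : realType) (m : nat) (l1 l2 : 'rV[R]_m -> R)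
    (a : R^o * R^o) (z : 'rV[R]_m * 'rV[R]_m) : R :=
  a.1 * l1 z.1 + a.2 * l2 z.2.

Lemma pair_loss_continuous (R : realType) (m : nat) (l1 l2 : 'rV[R]_m -> R)
    (a : R^o * R^o) :
  continuous l1 -> continuous l2 -> continuous (pair_loss l1 l2 a).
Proof.
move=> cl1 cl2 z; apply: cvgD; apply: cvgMr.
  by apply: (@cvg_comp _ _ _ fst l1); [exact: cvg_fst | exact: cl1].
by apply: (@cvg_comp _ _ _ snd l2); [exact: cvg_snd | exact: cl2].
Qed.

(** Translating by [zh] and dividing by the positive weights decouples the constraints into a
    product of sublevel sets. *)
Lemma Psi_valuesE (R : realType) (m : nat) (Z : set 'rV[R]_m)
    (c : 'rV[R]_m -> 'rV[R]_m -> R) (zh : 'rV[R]_m) (l1 l2 : 'rV[R]_m -> R)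
    (a be : R^o * R^o) :
  @weights R a ->
  Psi_values Z c zh l1 l2 a be = pair_loss l1 l2 a @`
    (cost_sublevel Z c zh (be.1 / a.1) `*` cost_sublevel Z c zh (be.2 / a.2)).
Proof.
move=> [_ a1 a2]; apply/seteqP; split => [_ [v [Z1 Z2 b1 b2] <-]|].
  exists (zh + v.1, zh + v.2) => //.
  by split; split => //=; rewrite ler_pdivlMr // mulrC.
move=> _ [z [[Z1 b1] [Z2 b2]] <-].
exists (z.1 - zh, z.2 - zh) => /=; rewrite !subrKC //.
by split => //; rewrite mulrC -ler_pdivlMr.
Qed.

Lemma Psi_is_max (R : realType) (m : nat) (Z : set 'rV[R]_m)
    (c : 'rV[R]_m -> 'rV[R]_m -> R) (zh : 'rV[R]_m) (l1 l2 : 'rV[R]_m -> R)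
    (b : R) (a be : R^o * R^o) :
  transport_cost Z c -> Z zh -> continuous l1 -> continuous l2 ->
  (forall s, compact (cost_sublevel Z c zh s)) ->
  @weights R a -> budgets b be ->
  is_max (Psi_values Z c zh l1 l2 a be) (Psi Z c zh l1 l2 a be).
Proof.
move=> hc Zzh cl1 cl2 cpt wa [_ be1 be2]; rewrite /Psi Psi_valuesE //.
have cl : continuous (pair_loss l1 l2 a) by exact: pair_loss_continuous.
set A := _ `*` _.
have A0 : A !=set0.
  case: wa => _ a1 a2; exists (zh, zh).
  by split; split => //=; rewrite (cost_refl hc Zzh) divr_ge0 // ltW.
have cA : compact A by exact: compact_setX.
have [u _ umax] := compact_image_max A0 cA cl.
by rewrite (is_max_sup umax); exact: umax.
Qed.

(** A maximizer [u] of the loss over the joint sublevel set bounds every [Psi], and some budget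
    split makes [u] feasible, so this bound is attained. *)
Lemma Phi_is_max (R : realType) (m : nat) (Z : set 'rV[R]_m)
    (c : 'rV[R]_m -> 'rV[R]_m -> R) (zh : 'rV[R]_m) (l1 l2 : 'rV[R]_m -> R)
    (b : R) (a : R^o * R^o) :
  transport_cost Z c -> closed Z -> Z zh -> continuous l1 -> continuous l2 ->
  (forall s, compact (cost_sublevel Z c zh s)) ->
  0 <= b -> @weights R a ->
  is_max (Phi_values Z c zh l1 l2 b a) (Phi Z c zh l1 l2 b a).
Proof.
move=> hc clZ Zzh cl1 cl2 cpt b0 wa.
have cl : continuous (pair_loss l1 l2 a) by exact: pair_loss_continuous.
have cJ : compact (joint_sublevel Z c zh b a) by exact: joint_sublevel_compact.
have J0 : joint_sublevel Z c zh b a !=set0.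
  by exists (zh, zh); split => //=; rewrite (cost_refl hc Zzh) !mulr0 addr0.
have [u [Zu1 Zu2 ub] [_ umax]] := compact_image_max J0 cJ cl.
have [_ a1 a2] := wa.
have Psi_le be : budgets b be ->
    Psi Z c zh l1 l2 a be <= pair_loss l1 l2 a u.
  move=> bbe; have [+ _] := Psi_is_max hc Zzh cl1 cl2 cpt wa bbe.
  rewrite {1}Psi_valuesE // => -[z [[Z1 z1] [Z2 z2]] <-].
  apply: umax; exists z => //; split => //.
  case: bbe => <- _ _; rewrite ler_pdivlMr // mulrC in z1.
  by rewrite ler_pdivlMr // mulrC in z2; exact: lerD.
suff umaxPhi : is_max (Phi_values Z c zh l1 l2 b a) (pair_loss l1 l2 a u).
  by rewrite /Phi (is_max_sup umaxPhi).
split => [|_ [be bbe <-]]; last exact: Psi_le.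
(* The first point receives exactly its weighted cost, the second the remainder. *)
pose be : R^o * R^o := (a.1 * c u.1 zh, b - a.1 * c u.1 zh).
have c1 := cost_ge0 hc Zu1 Zzh; have c2 := cost_ge0 hc Zu2 Zzh.
have bbe : budgets b be.
  split => /=; [by rewrite subrKC | by rewrite mulr_ge0 // ltW |].
  by rewrite subr_ge0; apply: le_trans ub; rewrite lerDl mulr_ge0 // ltW.
exists be => //; apply/eqP; rewrite eq_le Psi_le //=.
have [_] := Psi_is_max hc Zzh cl1 cl2 cpt wa bbe.
apply; rewrite Psi_valuesE //; exists u => //.
split; split => //=; rewrite ler_pdivlMr // mulrC //.
by rewrite lerBrDl.
Qed.

(** * Joint concavity by the perspective argument *)

(* The weights move into the convex combination of the points: this is the
   argument for joint convexity of a perspective function. *)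
Lemma perspective_conv (R : realType) (E : lmodType R) (D : set E)
    (g f : E -> R) (t a a' : R) (z z' : E) :
  @convex_set R E D -> @convex_function R E D g ->
  @concave_function R E setT f ->
  0 <= t -> t <= 1 -> 0 < a -> 0 < a' -> D z -> D z' ->
  exists w, [/\ D w,
    (t * a + (1 - t) * a') * g w <= t * (a * g z) + (1 - t) * (a' * g z')
    & t * (a * f z) + (1 - t) * (a' * f z') <= (t * a + (1 - t) * a') * f w].
Proof.
move=> cD cg cf t0 t1 a0 a'0 Dz Dz'.
set q := t * a + (1 - t) * a'.
have q0 : 0 < q by rewrite /q; nra.
(* Chosen so that [q * s = t * a] and [q * (1 - s) = (1 - t) * a']: scaling by [q] turns the
   convexity inequalities into the claims. *)
pose s := t * a / q.
have s0 : 0 <= s by rewrite divr_ge0 ?mulr_ge0 // ltW.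
have s1 : s <= 1 by rewrite ler_pdivrMr // mul1r /q lerDl mulr_ge0 ?subr_ge0 // ltW.
have qs : q * s = t * a by rewrite mulrC divfK // gt_eqF.
have qs' : q * (1 - s) = (1 - t) * a' by rewrite mulrBr mulr1 qs /q addrC addKr.
exists (s *: z + (1 - s) *: z'); split; first exact: convex_set_conv.
- have := convex_function_le cg Dz Dz' s0 s1.
  by rewrite !(mulrA t) !(mulrA (1 - t)) -qs -qs' -!(mulrA q) -mulrDr ler_pM2l.
- have := concave_function_ge cf I I s0 s1.
  by rewrite !(mulrA t) !(mulrA (1 - t)) -qs -qs' -!(mulrA q) -mulrDr ler_pM2l.
Qed.

(** The maximizers are combined separately in each of the two components. The cost bounds make the
    combined pair feasible for the averaged budgets; the loss bounds add up to the inequality. *)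
Lemma Psi_jointly_concave (R : realType) (m : nat) (Z : set 'rV[R]_m)
    (c : 'rV[R]_m -> 'rV[R]_m -> R) (zh : 'rV[R]_m) (l1 l2 : 'rV[R]_m -> R)
    (b t : R) (a a' be be' : R^o * R^o) :
  transport_cost Z c -> @convex_set R 'rV[R]_m Z -> Z zh ->
  @concave_function R 'rV[R]_m setT l1 -> @concave_function R 'rV[R]_m setT l2 ->
  (forall s, compact (cost_sublevel Z c zh s)) ->
  0 <= t -> t <= 1 -> @weights R a -> @weights R a' ->
  budgets b be -> budgets b be' ->
  t * Psi Z c zh l1 l2 a be + (1 - t) * Psi Z c zh l1 l2 a' be' <=
  Psi Z c zh l1 l2 (t *: a + (1 - t) *: a') (t *: be + (1 - t) *: be').
Proof.
move=> hc cZ Zzh cl1 cl2 cpt t0 t1 wa wa' bbe bbe'.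
have k1 := concave_continuous cl1; have k2 := concave_continuous cl2.
have [[v [Z1 Z2 b1 b2] <-] _] :=
  Psi_is_max hc Zzh k1 k2 cpt wa bbe.
have [[v' [Z1' Z2' b1' b2'] <-] _] :=
  Psi_is_max hc Zzh k1 k2 cpt wa' bbe'.
have wa'' := weights_conv t0 t1 wa wa'.
have bbe'' := budgets_conv t0 t1 bbe bbe'.
have [_ a1 a2] := wa; have [_ a1' a2'] := wa'.
have cc := cost_convex hc Zzh.
have [w1 [Zw1 cw1 lw1]] :=
  perspective_conv cZ cc cl1 t0 t1 a1 a1' Z1 Z1'.
have [w2 [Zw2 cw2 lw2]] :=
  perspective_conv cZ cc cl2 t0 t1 a2 a2' Z2 Z2'.
have [_ /(_ (pair_loss l1 l2 (t *: a + (1 - t) *: a') (w1, w2)))] :=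
  Psi_is_max hc Zzh k1 k2 cpt wa'' bbe''.
move=> H; apply: le_trans (H _); last first.
  exists (w1 - zh, w2 - zh); rewrite /= !subrKC //; split => //.
    by apply: (le_trans cw1); apply: lerD; apply: ler_wpM2l; rewrite ?subr_ge0.
  by apply: (le_trans cw2); apply: lerD; apply: ler_wpM2l; rewrite ?subr_ge0.
apply: le_trans (lerD lw1 lw2).
by rewrite !mulrDr addrACA.
Qed.

(** Partial maximization of a jointly concave function over a convex set: the average of two optimal
    budget splits is an admissible split for the averaged weights. *)
Lemma Phi_concave (R : realType) (m : nat) (Z : set 'rV[R]_m)
    (c : 'rV[R]_m -> 'rV[R]_m -> R) (zh : 'rV[R]_m) (l1 l2 : 'rV[R]_m -> R)
    (b : R) :
  transport_cost Z c -> closed Z -> @convex_set R 'rV[R]_m Z -> Z zh ->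
  @concave_function R 'rV[R]_m setT l1 -> @concave_function R 'rV[R]_m setT l2 ->
  (forall s, compact (cost_sublevel Z c zh s)) -> 0 <= b ->
  @concave_function R (R^o * R^o)%type (@weights R) (Phi Z c zh l1 l2 b).
Proof.
move=> hc clZ cZ Zzh cl1 cl2 cpt b0.
have k1 := concave_continuous cl1; have k2 := concave_continuous cl2.
apply: concave_functionI => t a a' t0 t1 wa wa'.
have [[be bbe <-] _] := Phi_is_max hc clZ Zzh k1 k2 cpt b0 wa.
have [[be' bbe' <-] _] := Phi_is_max hc clZ Zzh k1 k2 cpt b0 wa'.
have wa'' := weights_conv t0 t1 wa wa'.
have [_ ub] := Phi_is_max hc clZ Zzh k1 k2 cpt b0 wa''.
apply: le_trans (ub _ _); last first.
  by exists (t *: be + (1 - t) *: be') => //; exact: budgets_conv.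
exact: Psi_jointly_concave bbe bbe'.
Qed.

Unset Implicit Arguments.

Theorem lemma6 (R : realType) (n m N K : nat)
    (X : set 'rV[R]_n) (Z : set 'rV[R]_m)
    (c : 'rV[R]_m -> 'rV[R]_m -> R) (zhat : 'I_N -> 'rV[R]_m) (rho : R)
    (l : 'rV[R]_n -> 'rV[R]_m -> R)
    (lk : 'I_K -> 'rV[R]_n -> 'rV[R]_m -> R)
    (hc : transport_cost Z c)
    (hzhat : forall j, Z (zhat j))
    (hrho : 0 < rho)
    (hreg : regularity X Z c zhat rho l lk)
    (x : 'rV[R]_n) (hx : X x) (i : 'I_N)
    (k1 k2 : 'I_K) (hk : (k1 < k2)%N)
    (b : R) (hb : 0 <= b) :
  let psi := Psi Z c (zhat i) (lk k1 x) (lk k2 x) in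
  let phi := Phi Z c (zhat i) (lk k1 x) (lk k2 x) b in
  (* the maxima defining psi and phi exist, and psi and phi are these maxima *)
  (forall a be, @weights R a -> budgets b be ->
     is_max (Psi_values Z c (zhat i) (lk k1 x) (lk k2 x) a be) (psi a be)) /\
  (forall a, @weights R a ->
     is_max (Phi_values Z c (zhat i) (lk k1 x) (lk k2 x) b a) (phi a)) /\
  (* (i) *)
  (forall a, @weights R a ->
     @concave_function R (R^o * R^o)%type (budgets b) (psi a)) /\
  (* (ii) *)
  @concave_function R (R^o * R^o)%type (@weights R) phi.
Proof.
move=> psi phi.
have Zi := hzhat i.
have cl1 := reg_loss_concave hreg k1 x; have cl2 := reg_loss_concave hreg k2 x.
have clZ := reg_Z_closed hreg; have cZ := reg_Z_convex hreg.
have k1c := concave_continuous cl1; have k2c := concave_continuous cl2.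
have cpt s : compact (cost_sublevel Z c (zhat i) s).
  have [nu [p [hnu p1 grow _]]] := reg_growth hreg.
  by apply: (@cost_sublevel_compact _ _ _ _ _ nu p) => // z Zz; exact: grow.
split; first by move=> a be wa bbe; exact: Psi_is_max bbe.
split; first by move=> a wa; exact: Phi_is_max.
split; last exact: Phi_concave.
move=> a wa; apply: concave_functionI => t be be' t0 t1 bbe bbe'.
(* Claim (i) is joint concavity with equal weight vectors, so [a] is written as a convex combination
   of itself. *)
rewrite -[X in psi X (_ + _)](scaler_convmm t).
exact: Psi_jointly_concave bbe bbe'.
Qed.
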